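(* Let $Q\ge2$ and $D\ge2$ be integers, let $\mathcal{N}$ be a Poisson process with intensity $1$ on $\mathbb{R}_+$, and for $x\ge0$ let $$\mathcal{R}_1(x)=1+Q\sum_{p\ge0}\sum_{k=0}^{Q^p-1}\phi_{\mathcal{N}}\big(xk/Q^p,\,x(k+1)/Q^p\big),$$ where, for $0\le a\le b$, $\phi_{\mathcal{N}}(a,b)=1$ if $\mathcal{N}(]a,b])\ge D$ and $\phi_{\mathcal{N}}(a,b)=0$ otherwise. Then, for every $0<y\le Q$, almost surely, $$\lim_{N\to+\infty}\frac{\mathcal{R}_1(yQ^N)}{yQ^N}=Q\sum_{n\in\mathbb{Z}}\frac{1}{yQ^n}\mathbb{P}\big(\mathcal{N}(]0,yQ^n])\ge D\big)=Q\sum_{n\in\mathbb{Z}}\frac{1}{yQ^n}\int_0^{yQ^n}\frac{u^{D-1}}{(D-1)!}e^{-u}\,du=F_1(\log_Q y),$$ where $F_1$ is the periodic function with period $1$ defined by $$F_1(x)=\frac{Q^2}{Q-1}\int_0^{+\infty}Q^{-\{x-\log_Q u\}}\frac{u^{D-2}}{(D-1)!}e^{-u}\,du,$$ with $\{z\}=z-\lfloor z\rfloor$.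
   Context: $\mathcal{N}(A)$ is the number of points of the Poisson process $\mathcal{N}$ in $A$; $]a,b]$ is the half-open interval $(a,b]$; $\log_Q$ is the logarithm in base $Q$. (The variable $\mathcal{R}_1(x)$ has the distribution of the number of nodes of the tree of the symmetrical $Q$-ary splitting algorithm with threshold $D$ started with a Poisson($x$) number of items.) *)

(* Defs.v *)
From HB Require Import structures.
From mathcomp Require Import all_boot all_order all_algebra.
From mathcomp Require Import all_classical all_reals all_analysis.
From mathcomp Require Import measurable_realfun.

Set Implicit Arguments.
Unset Strict Implicit.
Unset Printing Implicit Defensive.
Import Order.TTheory GRing.Theory Num.Theory.
Import numFieldNormedType.Exports.
Local Open Scope classical_set_scope.
Local Open Scope ring_scope.

Definition mutually_independent (R : realType) (d : measure_display)
    (T : measurableType d) (P : probability T R) (n : nat)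
    (X : 'I_n -> T -> \bar R) : Prop :=
  forall B : 'I_n -> set (\bar R), (forall i, measurable (B i)) ->
    P (\bigcap_(i in [set: 'I_n]) (X i @^-1` B i)) =
    (\prod_(i < n) P (X i @^-1` B i))%E.

(* A point process on the line is a kernel N whose value N w is, for every
   outcome w, a locally finite integer-valued measure; N w A is the number of
   points in A, counted with multiplicity. It is Poisson with intensity measure
   mu when its counts have Poisson laws and are independent over disjoint sets.
   The second argument of poisson_prob is a dummy; at rate 0 it is the Dirac
   mass at 0. *)
Definition poisson_process (R : realType) (d : measure_display)
    (T : measurableType d) (P : probability T R)
    (mu : {measure set (measurableTypeR R) -> \bar R})
    (N : R.-ker T ~> measurableTypeR R) : Prop :=
  [/\ forall (w : T) (a b : R) (A : set (measurableTypeR R)),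
        measurable A -> A `<=` `[a, b] ->
        exists k : nat, N w A = k%:R%:E,
      forall A : set (measurableTypeR R), measurable A -> (mu A < +oo)%E ->
        forall k : nat,
        P [set w | N w A = k%:R%:E] = poisson_prob (fine (mu A)) 0 [set k] &
      forall (n : nat) (A : 'I_n -> set (measurableTypeR R)),
        (forall i, measurable (A i)) -> trivIset setT A ->
        mutually_independent P (fun i w => N w (A i))].

Definition lebesgue_Rplus (R : realType) :
    {measure set (measurableTypeR R) -> \bar R} :=
  mrestr (@lebesgue_measure R) (measurable_itv `[0, +oo[).

(* In phi and calR1, nu is a realization of the point process. *)
Definition phi (R : realType) (D : nat) (nu : set R -> \bar R) (a b : R) : R :=
  (D%:R%:E <= nu `]a, b]%classic)%E%:R.

(* The series has nonnegative terms and is summed in \bar R: it diverges to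
   +oo when nu has a point of multiplicity at least D in ]0, x]. *)
Definition calR1 (R : realType) (Q D : nat) (nu : set R -> \bar R) (x : R) :
    \bar R :=
  (1 + Q%:R%:E * \sum_(0 <= p <oo) \sum_(0 <= k < (Q ^ p)%N)
    (phi D nu (x * k%:R / Q%:R ^+ p) (x * k.+1%:R / Q%:R ^+ p))%:E)%E.

Definition frac (R : realType) (z : R) : R := z - (Num.floor z)%:~R.

Definition logb (R : realType) (Q : nat) (x : R) : R := ln x / ln Q%:R.

Definition F1 (R : realType) (Q D : nat) (x : R) : R :=
  Q%:R ^+ 2 / (Q%:R - 1) *
  \int[@lebesgue_measure R]_(u in `]0, +oo[)
    (Q%:R `^ (- frac (x - logb Q u)) * (u ^+ (D - 2) / (D - 1)`!%:R)
       * expR (- u)).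

(* Main.v *)
(* Since R_1(yQ^n) / (yQ^n) is 1 / (yQ^n) plus Q times the sum over the levels p
   of Z(n, p), where Z(n, p) is the average of the Q^p indicators of level p
   divided by the length yQ^(n-p) of the intervals of that level, it has the
   expected limit as soon as, almost surely, the sum over p of
   |Z(n, p) - E Z(n, p)| tends to 0. The indicators of one level being pairwise
   independent, Var Z(n, p) <= Q^p q / (yQ^n)^2, where q is the probability of
   at least D >= 2 points in an interval of length yQ^(n-p). As q is at most 1
   and at most (yQ^(n-p))^2, this variance is O(Q^(- max(n, p))), so that
   E|Z(n, p) - E Z(n, p)| is summable over both n and p. The formula for F_1
   is Tonelli's theorem and a geometric sum over the n with u <= yQ^n. *)
Require Import Defs.
From mathcomp Require Import all_boot all_order all_algebra.
From mathcomp Require Import all_classical all_reals all_analysis.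
From mathcomp Require Import measurable_realfun.
From mathcomp Require Import ring lra zify.
Import Order.TTheory GRing.Theory Num.Theory.
Import numFieldNormedType.Exports.
Local Open Scope classical_set_scope.
Local Open Scope ring_scope.

(** * Poisson tails and their integral form *)

(** The probability that a Poisson variable of mean x is at least D. *)
Definition poisson_tail {R : realType} (D : nat) (x : R) : R :=
  1 - \sum_(k < D) x ^+ k / k`!%:R * expR (- x).

Lemma poisson_tailS {R : realType} (D : nat) (x : R) :
  poisson_tail D.+1 x = poisson_tail D x - x ^+ D / D`!%:R * expR (- x).
Proof. by rewrite /poisson_tail big_ord_recr /= opprD addrA. Qed.

Lemma is_derive_exprn {R : realType} (n : nat) (x : R) :
  is_derive x 1 (fun z : R => z ^+ n) (n%:R * x ^+ n.-1).
Proof.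
have := is_deriveX n (is_derive_id x 1).
by rewrite exprfctE /GRing.scale /= mulr1.
Qed.

(** The derivative telescopes: passing from D + 1 to D + 2 subtracts a term with derivative x^D/D!
    e^-x - x^(D+1)/(D+1)! e^-x, whose first part cancels the density already obtained. *)
Lemma is_derive_poisson_tail {R : realType} (D : nat) (x : R) :
  is_derive x 1 (poisson_tail D.+1)
    (x ^+ D / D`!%:R * expR (- x)).
Proof.
elim: D => [|D IH].
  have -> : @poisson_tail R 1 = fun x => 1 - expR (- x).
    by apply/funext => z; rewrite /poisson_tail big_ord1 expr0 divr1 mul1r.
  apply: is_derive_eq; rewrite /GRing.scale /=. rewrite expr0 fact0 divr1; ring.
have -> : @poisson_tail R D.+2 = fun x =>
    poisson_tail D.+1 x - (D.+1)`!%:R^-1 * (x ^+ D.+1 * expR (- x)).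
  by apply/funext => z; rewrite poisson_tailS [X in _ - X * _]mulrC mulrA.
have f0 : (D`!%:R : R) != 0 by rewrite pnatr_eq0 -lt0n fact_gt0.
have d1 : (D.+1%:R : R) != 0 by rewrite pnatr_eq0.
have dX := is_derive_exprn D.+1 x.
apply: is_derive_eq; rewrite /GRing.scale /= factS natrM exprS.
by field; rewrite f0; apply/andP; split=> //; rewrite nat1r.
Qed.

Lemma poisson_tail0 {R : realType} (D : nat) :
  poisson_tail D.+1 (0 : R) = 0.
Proof.
rewrite /poisson_tail big_ord_recl big1 => [|i _]; last first.
  by rewrite exprS mul0r !mul0r.
by rewrite expr0 divr1 oppr0 expR0 mul1r addr0 subrr.
Qed.

Lemma poisson_tail_le1 {R : realType} (D : nat) (x : R) :
  0 <= x -> poisson_tail D x <= 1.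
Proof.
move=> x0; rewrite lerBlDr lerDl sumr_ge0 // => k _.
by rewrite mulr_ge0 ?expR_ge0 // divr_ge0 ?exprn_ge0.
Qed.

(** The tail decreases in D, so D = 2 suffices, and 1 - (1 + x) e^-x <= x^2 follows from e^-x >= 1 -
    x. The quadratic order at 0 is what makes the levels with short intervals summable. *)
Lemma poisson_tail_le_sqr {R : realType} (D : nat) (x : R) :
  (2 <= D)%N -> 0 <= x -> poisson_tail D x <= x ^+ 2.
Proof.
case: D => [|[|D]] // _ x0.
suff: poisson_tail 2 x <= x ^+ 2.
  elim: D => [//|D IH] /IH; apply: le_trans; rewrite [leLHS]poisson_tailS.
  by rewrite lerBlDr lerDl mulr_ge0 ?expR_ge0 // divr_ge0 ?exprn_ge0.
rewrite /poisson_tail !big_ord_recr big_ord0 /= !expr1 expr0 !divr1.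
have := @expR_ge1Dx R (- x); nra.
Qed.

(** Fundamental theorem of calculus: the tail is a primitive of the Gamma density and vanishes at
    0. *)
Lemma integral_poisson_tail {R : realType} (D : nat) (x : R) : 0 < x ->
  (\int[@lebesgue_measure R]_(u in `[0%R, x])
      (u ^+ D / D`!%:R * expR (- u))%:E)%E = (poisson_tail D.+1 x)%:E.
Proof.
move=> x0; rewrite (@continuous_FTC2 _ _ (poisson_tail D.+1)) //.
- by rewrite poisson_tail0 sube0.
- apply: derivable_within_continuous => y _.
  suff: derivable (fun u : R => u ^+ D / D`!%:R * expR (- u)) y 1 by [].
  have dX := is_derive_exprn D y.
  exact: ex_derive.
- have der y : derivable (@poisson_tail R D.+1) y 1.
    by have [] := is_derive_poisson_tail D y.
  have cont : continuous (@poisson_tail R D.+1).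
    by move=> y; apply/differentiable_continuous/derivable1_diffP.
  by split => [y _ //||];
    [apply: cvg_at_right_filter|apply: cvg_at_left_filter]; exact: cont.
- move=> y _; rewrite derive1E.
  exact: (@derive_val _ _ _ _ _ _ _ (is_derive_poisson_tail D y)).
Qed.

Lemma poisson_tail_ge0 {R : realType} (D : nat) (x : R) :
  0 <= x -> 0 <= poisson_tail D.+1 x.
Proof.
rewrite le_eqVlt => /predU1P[<-|x0]; first by rewrite poisson_tail0.
rewrite -lee_fin -integral_poisson_tail //; apply: integral_ge0 => u.
rewrite /= in_itv /= => /andP[u0 _].
by rewrite lee_fin mulr_ge0 ?expR_ge0 // divr_ge0 ?exprn_ge0.
Qed.

Lemma lebesgue_Rplus_itv {R : realType} (a b : R) : 0 <= a -> a <= b ->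
  lebesgue_Rplus R `]a, b]%classic = (b - a)%:E.
Proof.
move=> a0 ab; rewrite /lebesgue_Rplus /= /mrestr. rewrite setIidl; last first.
  by move=> x /=; rewrite !in_itv /= andbT => /andP[/ltW/(le_trans a0)].
rewrite lebesgue_measure_itv /= lte_fin EFinB.
by move: ab; rewrite le_eqVlt => /predU1P[->|->]; rewrite ?ltxx ?subee.
Qed.

Lemma poisson_prob_set1 {R : realType} (r : R) (k : nat) : 0 <= r ->
  poisson_prob r 0 [set k] = (r ^+ k / k`!%:R * expR (- r))%:E.
Proof.
move=> r0; rewrite /poisson_prob /poisson_pmf.
case: ltP => [rp|rn]; first by rewrite esum_set1 // lee_fin mulr_ge0 ?expR_ge0 ?divr_ge0 ?exprn_ge0.
(* At rate 0 the law is the Dirac mass at 0, which agrees with the formula because 0^0 = 1. *)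
have -> : r = 0 by apply/eqP; rewrite eq_le rn.
rewrite oppr0 expR0 mulr1 diracE expr0n.
case: k => [|k]; first by rewrite mem_set //= divr1.
by rewrite memNset //= mul0r.
Qed.

(** * Intervals with at least D points *)

(** The event whose indicator is [phi]; with a = 0 it is the event in the theorem. *)
Definition crowded {R : realType} {d : measure_display} {T : measurableType d}
    (N : R.-ker T ~> measurableTypeR R) (D : nat) (a b : R) : set T :=
  [set w | (D%:R%:E <= N w `]a, b]%classic)%E].

Section poisson_events.
Context {R : realType} {d : measure_display} {T : measurableType d}
  {P : probability T R} {N : R.-ker T ~> measurableTypeR R}.
Hypothesis hN : poisson_process P (lebesgue_Rplus R) N.

Lemma measurable_crowded D a b : measurable (crowded N D a b).
Proof.
have mN := measurable_kernel N _ (measurable_itv `]a, b]).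
have := mN measurableT _ (emeasurable_itv `[D%:R%:E, +oo[); rewrite setTI.
by congr measurable; apply/seteqP; split => w; rewrite /crowded /= in_itv /= andbT.
Qed.

(** Induction on D: counts being integers, at least D points means either at least D + 1 or exactly
    D, and the latter has the Poisson weight that separates consecutive tails. *)
Lemma probability_crowded D a b : 0 <= a -> a <= b ->
  P (crowded N D a b) = (poisson_tail D (b - a))%:E.
Proof.
move=> a0 ab; have [hint hlaw _] := hN.
have mN := measurable_kernel N _ (measurable_itv `]a, b]).
have mE k : measurable [set w | N w `]a, b]%classic = k%:R%:E].
  by have := mN measurableT _ (emeasurable_set1 k%:R%:E); rewrite setTI.
elim: D => [|D IH].
  have -> : crowded N 0 a b = setT by apply/seteqP; split => // w _; exact: measure_ge0.
  by rewrite probability_setT /poisson_tail big_ord0 subr0.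
have eqD : crowded N D a b = crowded N D.+1 a b `|`
    [set w | N w `]a, b]%classic = D%:R%:E].
  apply/seteqP; split => w; rewrite /crowded /=.
    have [k ->] : exists k : nat, N w `]a, b]%classic = k%:R%:E.
      apply: (hint w a b); first exact: measurable_itv.
      by move=> x /=; rewrite !in_itv /= => /andP[/ltW -> ->].
    by rewrite !lee_fin !ler_nat leq_eqVlt => /predU1P[->|]; [right|left].
  case=> [|-> //]; apply: le_trans; by rewrite lee_fin ler_nat.
have mab : measurable (`]a, b]%classic : set (measurableTypeR R)).
  exact: measurable_itv.
have PU : P (crowded N D a b) =
    (P (crowded N D.+1 a b) + P [set w | N w `]a, b]%classic = D%:R%:E])%E.
  rewrite eqD measureU //; first exact: measurable_crowded.
  apply/seteqP; split => // w [] /=; rewrite /crowded /= => + eD.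
  by rewrite eD lee_fin ler_nat ltnn.
have muab : (lebesgue_Rplus R `]a, b]%classic < +oo)%E.
  by rewrite lebesgue_Rplus_itv // ltry.
move: PU; rewrite IH hlaw // lebesgue_Rplus_itv //= poisson_prob_set1 ?subr_ge0 //.
by move=> PU; rewrite poisson_tailS EFinB PU addeK.
Qed.

(** Half-open intervals sharing at most an endpoint are disjoint, so independence applies to the
    family of these two. *)
Lemma probability_crowdedI D a b a' b' :
  0 <= a -> a <= b -> b <= a' -> a' <= b' ->
  P (crowded N D a b `&` crowded N D a' b') =
  (P (crowded N D a b) * P (crowded N D a' b'))%E.
Proof.
move=> a0 ab ba' a'b'; have [_ _ hind] := hN.
pose A (i : 'I_2) : set (measurableTypeR R) :=
  if i == 0 then `]a, b]%classic else `]a', b']%classic.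
have mA i : measurable (A i) by rewrite /A; case: ifP => _; exact: measurable_itv.
have dA : trivIset setT A.
  have AB x : `]a, b]%classic x -> ~ `]a', b']%classic x.
    rewrite /= !in_itv /= => /andP[_ xb] /andP[xa _].
    by have := lt_le_trans xa (le_trans xb ba'); rewrite ltxx.
  move=> i j _ _; rewrite /A => -[x []].
  have [->|i0] := eqVneq i 0; have [->|j0] := eqVneq j 0 => //.
  - by move=> /AB.
  - by move=> + /AB.
  - move=> _ _; apply/val_inj => /=.
    by move: i0 j0; case: i => -[|[|]] // ?; case: j => -[|[|]].
(* In the extended reals this half-line contains +oo, so its preimage is the whole event. *)
have := hind 2 A mA dA (fun=> `[D%:R%:E, +oo[%classic) (fun=> emeasurable_itv _).
have crE a1 b1 : (fun w => N w `]a1, b1]%classic) @^-1` `[D%:R%:E, +oo[%classic =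
    crowded N D a1 b1.
  by apply/seteqP; split => w; rewrite /crowded /= in_itv /= andbT.
rewrite !big_ord_recr big_ord0 Monoid.mul1m /= !crE => <-; congr (P _).
apply/seteqP; split => [w [h h'] i _|w h].
  by rewrite /A; case: ifP => _ /=; rewrite in_itv /= andbT.
split.
  have := h ord0 I; by rewrite /= in_itv /= andbT.
have := h ord_max I; by rewrite /= in_itv /= andbT.
Qed.
End poisson_events.

(** * Second moment bounds for the number of pairwise independent events *)

Section pairwise_independent_events.
Context {R : realType} {d : measure_display} {T : measurableType d}
  {P : probability T R} {A : nat -> set T} {K : nat} {q : R}.
Hypothesis mA : forall k, measurable (A k).
Hypothesis PA : forall k, (k < K)%N -> P (A k) = q%:E.
Hypothesis PAI : forall j k, (j < k < K)%N -> P (A j `&` A k) = (q ^+ 2)%:E.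

Let S w : R := \sum_(0 <= k < K) \1_(A k) w.

Let mS : measurable_fun setT S.
Proof. by apply: measurable_sum => k; exact: measurable_indic. Qed.

Let S_ge0 w : 0 <= S w.
Proof. by apply: sumr_ge0. Qed.

Let integral_cst_P (r : R) : (\int[P]_w r%:E = r%:E)%E.
Proof.
rewrite integral_cst //; have := @probability_setT _ _ _ P => PT.
by rewrite (_ : (P : measure T R) setT = 1%E) ?mule1.
Qed.

Let integral_sum_indic (B : nat -> set T) : (forall k, measurable (B k)) ->
  (\int[P]_w \sum_(0 <= k < K) (\1_(B k) w)%:E = \sum_(0 <= k < K) P (B k))%E.
Proof.
move=> mB; rewrite ge0_integral_sum //=.
- by apply: eq_bigr => k _; rewrite integral_indic // setIT.
- by move=> k; apply/measurable_EFinP; exact: measurable_indic.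
Qed.

Let expectation_count : (\int[P]_w (S w)%:E = (K%:R * q)%:E)%E.
Proof.
under eq_integral do rewrite -sumEFin.
rewrite integral_sum_indic // (eq_big_nat _ _ (F2 := fun=> q%:E)).
  by rewrite sumEFin sumr_const_nat subn0 mulr_natl.
by move=> k /andP[_ kK]; rewrite PA.
Qed.

(** Expanding the square gives K diagonal terms q and K(K - 1) terms q^2, so only pairs of events
    matter. *)
Let expectation_count_sqr :
  (\int[P]_w (S w ^+ 2)%:E = (K%:R * q + (K * K.-1)%:R * q ^+ 2)%:E)%E.
Proof.
have SE w : (S w ^+ 2)%:E =
    (\sum_(0 <= j < K) \sum_(0 <= k < K) (\1_(A j `&` A k) w)%:E)%E.
  rewrite expr2 /S mulr_suml -sumEFin; apply: eq_bigr => j _.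
  rewrite mulr_sumr -sumEFin; apply: eq_bigr => k _.
  by rewrite indicI.
under eq_integral do rewrite SE.
have mI j k : measurable (A j `&` A k) by exact: measurableI.
rewrite ge0_integral_sum //=; [|move=> j; apply: emeasurable_sum => k|]; last 2 first.
- by apply/measurable_EFinP; exact: measurable_indic.
- by move=> j w _; apply: sume_ge0 => k _; rewrite lee_fin.
rewrite (eq_big_nat _ _ (F2 := fun=> (q + K.-1%:R * q ^+ 2)%:E)).
  rewrite sumEFin sumr_const_nat subn0 -mulr_natl natrM; congr (_%:E); ring.
move=> j /andP[_ jK]; rewrite integral_sum_indic //.
rewrite big_mkord (bigD1 (Ordinal jK)) //= setIid PA //.
rewrite (eq_bigr (fun=> (q ^+ 2)%:E)) => [|k].
  rewrite sumEFin sumr_const -EFinD; congr (_%:E); congr (_ + _).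
  by rewrite cardC1 card_ord mulr_natl.
rewrite -val_eqE /= => kj.
have [jk|kj'] := ltnP j k; first by rewrite PAI ?jk /=.
by rewrite setIC PAI // ltn_neqAle kj kj' /=.
Qed.

Let variance_count : 0 <= q ->
  (\int[P]_w ((S w - K%:R * q) ^+ 2)%:E <= (K%:R * q)%:E)%E.
Proof.
move=> q0; set m := K%:R * q.
have m0 : 0 <= m by rewrite mulr_ge0.
have mdev2 : measurable_fun setT (fun w => (S w - m) ^+ 2).
  by apply: measurable_funX; exact: measurable_funB.
(* The expansion of the square is arranged with nonnegative terms on both sides, so that additivity
   of the integral of nonnegative functions applies. *)
have id : (\int[P]_w (((S w - m) ^+ 2)%:E + (m *+ 2)%:E * (S w)%:E) =
    \int[P]_w ((S w ^+ 2)%:E + (m ^+ 2)%:E))%E.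
  by apply: eq_integral => w _; rewrite -EFinM -!EFinD; congr (_%:E); ring.
move: id; rewrite ge0_integralD //=.
- rewrite ge0_integralZl_EFin //=.
  + rewrite ge0_integralD //=.
    * rewrite expectation_count expectation_count_sqr integral_cst_P.
      rewrite -/m -EFinM -EFinD => id.
      rewrite -(@leeD2rE _ (m *+ 2 * m)%:E) // id -EFinD lee_fin.
      suff : (K * K.-1)%:R * q ^+ 2 <= m ^+ 2 by lra.
      rewrite /m exprMn ler_wpM2r ?sqr_ge0 // -natrX ler_nat expnS expn1.
      by rewrite leq_mul2l leq_pred orbT.
    * by move=> w _; rewrite lee_fin sqr_ge0.
    * by apply/measurable_EFinP; exact: measurable_funX.
    * by move=> w _; rewrite lee_fin sqr_ge0.
  + by move=> w _; rewrite lee_fin.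
  + exact/measurable_EFinP.
  + by rewrite mulrn_wge0.
- by move=> w _; rewrite lee_fin sqr_ge0.
- exact/measurable_EFinP.
- by move=> w _; rewrite -EFinM lee_fin mulr_ge0 ?mulrn_wge0.
- by apply: measurable_funeM; exact/measurable_EFinP.
Qed.

(** A substitute for the Cauchy-Schwarz inequality that avoids square roots: the weight t stays
    free, to be chosen level by level so that both terms decay geometrically. *)
Lemma count_L1_deviation (c t : R) : 0 < t -> 0 <= q ->
  (\int[P]_w `|c * (S w - K%:R * q)|%:E <=
   (2^-1 * (t * (c ^+ 2 * (K%:R * q)) + t^-1))%:E)%E.
Proof.
move=> t0 q0; set m := K%:R * q.
have t'0 : 0 < t^-1 by rewrite invr_gt0.
have tc0 : 0 <= 2^-1 * t * c ^+ 2 by rewrite mulr_ge0 ?sqr_ge0 // mulr_ge0 // ltW.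
have t20 : 0 <= 2^-1 * t^-1 by rewrite mulr_ge0 // ltW.
have mdev : measurable_fun setT (fun w => S w - m) by exact: measurable_funB.
have mdev2 : measurable_fun setT (EFin \o (fun w => (S w - m) ^+ 2)).
  by apply/measurable_EFinP; exact: measurable_funX.
have mdev2c : measurable_fun setT
    (fun w => ((2^-1 * t * c ^+ 2)%:E * ((S w - m) ^+ 2)%:E)%E).
  exact: measurable_funeM.
(* AM-GM: |a| <= (t a^2 + 1/t) / 2. *)
apply: (@le_trans _ _ (\int[P]_w
    ((2^-1 * t * c ^+ 2)%:E * ((S w - m) ^+ 2)%:E + (2^-1 * t^-1)%:E))%E).
  apply: ge0_le_integral => //=.
  - apply/measurable_EFinP; apply: measurableT_comp => //.
    exact: measurable_funM.
  - exact: emeasurable_funD.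
  - move=> w _; rewrite -EFinM -EFinD lee_fin.
    set a := S w - m; rewrite ler_norml.
    (* With u = t c a, both inequalities reduce to the nonnegativity of (u + 1)^2 and (u - 1)^2. *)
    have -> : 2^-1 * t * c ^+ 2 * a ^+ 2 + 2^-1 * t^-1 =
        2^-1 * t^-1 * ((t * (c * a)) ^+ 2 + 1) by field; rewrite gt_eqF.
    have cE : c * a = t^-1 * (t * (c * a)) by field; rewrite gt_eqF.
    rewrite [X in _ <= X <= _]cE; move: (t * (c * a)) => u.
    apply/andP; split.
      rewrite -subr_ge0.
      have -> : t^-1 * u - - (2^-1 * t^-1 * (u ^+ 2 + 1)) =
          2^-1 * t^-1 * (u + 1) ^+ 2 by field; rewrite gt_eqF.
      by rewrite mulr_ge0 ?sqr_ge0.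
    rewrite -subr_ge0.
    have -> : 2^-1 * t^-1 * (u ^+ 2 + 1) - t^-1 * u =
        2^-1 * t^-1 * (u - 1) ^+ 2 by field; rewrite gt_eqF.
    by rewrite mulr_ge0 ?sqr_ge0.
rewrite ge0_integralD //=.
- rewrite ge0_integralZl_EFin //=.
  + rewrite integral_cst_P.
    have -> : 2^-1 * (t * (c ^+ 2 * m) + t^-1) =
        2^-1 * t * c ^+ 2 * m + 2^-1 * t^-1 by ring.
    rewrite EFinD leeD2r //.
    by apply: le_trans (lee_wpmul2l _ (variance_count q0)) _; rewrite ?lee_fin.
  + by move=> w _; rewrite lee_fin sqr_ge0.
- by move=> w _; rewrite -EFinM lee_fin mulr_ge0 ?sqr_ge0.
Qed.
End pairwise_independent_events.

(** * Nonnegative series over the naturals and the integers *)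

Lemma nneseries_geometric {R : realType} (a r : R) : 0 <= a -> 0 <= r < 1 ->
  (\sum_(0 <= i <oo) (a * r ^+ i)%:E = (a / (1 - r))%:E)%E.
Proof.
move=> a0 /andP[r0 r1]; apply/cvg_lim => //.
under eq_fun do rewrite sumEFin.
apply: cvg_EFin; first by near=> n.
by apply: cvg_geometric_series; rewrite ger0_norm.
Unshelve. all: by end_near. Qed.

Lemma nneseries_geometric2_lty {R : realType} (a r : R) : 0 <= a -> 0 <= r < 1 ->
  (\sum_(0 <= n <oo) \sum_(0 <= p <oo) (a * r ^+ (n + p))%:E < +oo)%E.
Proof.
move=> a0 r01; have /andP[r0 r1] := r01.
under eq_eseriesr => n _.
  under eq_eseriesr do rewrite exprD mulrA.
  rewrite nneseries_geometric ?mulr_ge0 ?exprn_ge0 // mulrAC.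
  over.
by rewrite nneseries_geometric ?ltry // divr_ge0 // subr_ge0 ltW.
Qed.

(** Each term is at most the tail of the series from its index on, and the tails of a finite sum
    tend to 0. *)
Lemma nneseries_lty_cvg0 {R : realType} (u : (\bar R)^nat) :
  (forall n, 0 <= u n)%E -> (\sum_(0 <= n <oo) u n < +oo)%E ->
  u n @[n --> \oo] --> 0%E.
Proof.
move=> u0 uoo.
have := nneseries_tail_cvg uoo (fun n _ => u0 n).
apply: squeeze_cvge; last exact: cvg_cst.
near=> n; rewrite u0 /= (nneseries_split n 1) //.
by rewrite addn1 big_nat1 leeDl // nneseries_ge0.
Unshelve. all: by end_near. Qed.

(** The two constructors of [int] split Z into two images of the naturals, [Negz i] being -(i + 1);
    sums over Z thus reduce to two series. *)
Lemma esum_int {R : realType} (a : int -> \bar R) : (forall n, 0 <= a n)%E ->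
  (\esum_(n in [set: int]) a n =
   \sum_(0 <= i <oo) a (Posz i) + \sum_(0 <= i <oo) a (Negz i))%E.
Proof.
move=> a0; rewrite (esumID (range Posz)) // !setTI.
have -> : ~` range Posz = range Negz.
  apply/seteqP; split => [[n|n]|] /=; first by case; exists n.
    by exists n.
  by move=> _ [n _ <-] [m].
have bij (e : nat -> int) : injective e -> set_bij setT (range e) e.
  by move=> einj; split => // m n _ _ /einj.
by congr (_ + _)%E; rewrite nneseries_esumT //; apply/reindex_esum/bij => m n [].
Qed.

(** For fixed n, the index n - p runs through the integers at most n, and these sets exhaust Z as n
    grows. *)
Lemma cvg_nneseries_shift_int {R : realType} (m : int -> \bar R) :
  (forall n, 0 <= m n)%E ->
  (\sum_(0 <= p <oo) m (n%:Z - p%:Z)%R)%E @[n --> \oo] -->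
  (\esum_(n in [set: int]) m n)%E.
Proof.
move=> m0; rewrite esum_int //.
have -> : (fun n : nat => \sum_(0 <= p <oo) m (n%:Z - p%:Z)%R)%E =
    (fun n : nat => \sum_(0 <= i < n.+1) m (Posz i) +
      \sum_(0 <= i <oo) m (Negz i))%E.
  (* The first n + 1 terms, reversed, carry the indices 0 to n; the term of rank n + 1 + i has index
     [Negz i]. *)
  apply/funext => n; rewrite (nneseries_split 0 n.+1) // add0n; congr (_ + _)%E.
    rewrite big_nat_rev add0n; apply: eq_big_nat => i /andP[_ ni].
    by congr (m _); lia.
  rewrite -nneseries_addn //; apply: eq_eseriesr => i _.
  by congr (m _); lia.
apply: cvgeD.
- by apply: ge0_adde_def; rewrite inE; apply: nneseries_ge0.
- have := @is_cvg_nneseries R (m \o Posz) xpredT 0 (fun n _ _ => m0 n).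
  by rewrite -(cvg_shiftS (fun n => \sum_(0 <= i < n) m (Posz i))%E).
- exact: cvg_cst.
Qed.

Lemma abse_diff_le {R : realType} (a b : R) :
  (a%:E <= b%:E + `|a - b|%:E)%E.
Proof. by rewrite -EFinD lee_fin -lerBlDl ler_norm. Qed.

(** With M n the sum of m over the integers at most n and D n the l1 distance, the n-th series lies
    between M n - D n and M n + D n. *)
Lemma cvg_nneseries_approx {R : realType} (a : nat -> nat -> R) (m : int -> R) :
  (forall n p, 0 <= a n p) -> (forall n, 0 <= m n) ->
  (\esum_(n in [set: int]) (m n)%:E < +oo)%E ->
  (\sum_(0 <= p <oo) `|a n p - m (n%:Z - p%:Z)|%:E)%E @[n --> \oo] --> 0%E ->
  (\sum_(0 <= p <oo) (a n p)%:E)%E @[n --> \oo] -->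
  (\esum_(n in [set: int]) (m n)%:E)%E.
Proof.
move=> a0 m0 moo dev0.
set D := (fun n : nat => \sum_(0 <= p <oo) _)%E in dev0.
pose M (n : nat) := (\sum_(0 <= p <oo) (m (n%:Z - p%:Z))%:E)%E.
have cM : M n @[n --> \oo] --> (\esum_(n in [set: int]) (m n)%:E)%E.
  by apply: (@cvg_nneseries_shift_int _ (fun n => (m n)%:E)) => n; rewrite lee_fin.
have sfin : (\esum_(n in [set: int]) (m n)%:E)%E \is a fin_num.
  by rewrite ge0_fin_numE // esum_ge0 // => n _; rewrite lee_fin.
have lo : (M n - D n)%E @[n --> \oo] --> (\esum_(n in [set: int]) (m n)%:E)%E.
  rewrite -[X in _ --> X]sube0; apply: cvgeB => //.
  by rewrite fin_num_adde_defl.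
have hi : (M n + D n)%E @[n --> \oo] --> (\esum_(n in [set: int]) (m n)%:E)%E.
  rewrite -[X in _ --> X]adde0; apply: cvgeD => //.
  by rewrite fin_num_adde_defl.
apply: squeeze_cvge lo hi.
have D0 n : (0 <= D n)%E by apply: nneseries_ge0.
near=> n.
(* D n is finite for large n only, and must be finite to be moved across an inequality. *)
have Dfin : D n \is a fin_num by near: n; case/fine_cvgP: dev0.
apply/andP; split.
  rewrite leeBlDr //.
  rewrite -nneseriesD => [|p _ _|p _ _]; rewrite ?lee_fin //.
  apply: lee_nneseries => p *; first by rewrite lee_fin.
  by rewrite distrC abse_diff_le.
rewrite -nneseriesD => [|p _ _|p _ _]; rewrite ?lee_fin //.
by apply: lee_nneseries => [p _ _|p _]; [rewrite lee_fin|exact: abse_diff_le].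
Unshelve. all: by end_near. Qed.

(** * Almost sure convergence and decay rates *)

(** By Tonelli the double series has finite expectation, hence is almost surely finite, and the
    terms of its outer series then tend to 0. *)
Lemma nneseries_integral_lty_ae_cvg0 {R : realType} {d : measure_display}
    {T : measurableType d} (P : probability T R) (f : nat -> nat -> T -> R) :
  (forall n p, measurable_fun setT (f n p)) -> (forall n p w, 0 <= f n p w) ->
  (\sum_(0 <= n <oo) \sum_(0 <= p <oo) \int[P]_w (f n p w)%:E < +oo)%E ->
  {ae P, forall w, (\sum_(0 <= p <oo) (f n p w)%:E)%E @[n --> \oo] --> 0%E}.
Proof.
move=> mf f0 foo.
pose g n w := (\sum_(0 <= p <oo) (f n p w)%:E)%E.
have mfE n p : measurable_fun setT (EFin \o f n p) by exact/measurable_EFinP.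
have mg n : measurable_fun setT (g n).
  apply: (ge0_emeasurable_sum (P := xpredT)) => [p w _ _|p _].
    by rewrite lee_fin.
  exact: mfE.
have g0 n w : (0 <= g n w)%E by apply: nneseries_ge0 => p _ _; rewrite lee_fin.
pose G w := (\sum_(0 <= n <oo) g n w)%E.
have mG : measurable_fun setT G.
  exact: (ge0_emeasurable_sum (P := xpredT) (fun n w _ _ => g0 n w) (fun n _ => mg n)).
have G0 w : (0 <= G w)%E by apply: nneseries_ge0.
have iE n : (\int[P]_w g n w = \sum_(0 <= p <oo) \int[P]_w (f n p w)%:E)%E.
  by apply: integral_nneseries => // [p|p w _]; [exact: mfE|rewrite lee_fin].
have iG : P.-integrable setT G.
  apply/integrableP; split => //.
  under eq_integral do rewrite gee0_abs //.
  rewrite integral_nneseries //.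
  under eq_eseriesr do rewrite iE.
  by [].
have := integrable_ae measurableT iG.
apply: filterS => w /(_ I); rewrite ge0_fin_numE // => Goo.
exact: (@nneseries_lty_cvg0 _ (fun n => g n w) (fun n => g0 n w) Goo).
Qed.

(* (5/7)^2 >= 1/2 >= 1/Q; the exponent 2 * max(n, p) >= n + p is what is needed. *)
Lemma invX_le_5_7 {R : realFieldType} (Q m k : nat) : (2 <= Q)%N ->
  (k <= m + m)%N -> ((Q%:R ^+ m)^-1 : R) <= (5%:R / 7%:R) ^+ k.
Proof.
move=> Q2 km; have Q2R : (2%:R : R) <= Q%:R by rewrite ler_nat.
apply: (@le_trans _ _ ((5%:R / 7%:R) ^+ (m + m))); last first.
  by apply: ler_wiXn2l => //; lra.
have Qr : (Q%:R^-1 : R) <= 5%:R / 7%:R * (5%:R / 7%:R).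
  apply: (@le_trans _ _ 2^-1); last by lra.
  by rewrite lef_pV2 ?posrE //; lra.
rewrite exprD -exprMn -exprVn; apply: lerXn2r => //; rewrite nnegrE ?invr_ge0 //.
Qed.

(** A bound on the variance at level p. For p <= n, q <= 1 gives y^-2 Q^-n; for p > n, the quadratic
    bound gives exactly Q^-p. The constant 1 + y^-2 covers both cases. *)
Lemma deviation_rate {R : realFieldType} (Q n p : nat) (y q : R) :
  (2 <= Q)%N -> 0 < y -> 0 <= q -> q <= 1 ->
  q <= (y * Q%:R ^+ n / Q%:R ^+ p) ^+ 2 ->
  (y * Q%:R ^+ n)^-1 ^+ 2 * (Q%:R ^+ p * q) <=
  (1 + (y ^+ 2)^-1) * (5%:R / 7%:R) ^+ (n + p).
Proof.
move=> Q2 y0 q0 q1 ql.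
have Q0 : (0 : R) < Q%:R by rewrite ltr0n (leq_trans _ Q2).
have Qn0 k : (0 : R) < Q%:R ^+ k by rewrite exprn_gt0.
have y2 : 0 < (y ^+ 2)^-1 by rewrite invr_gt0 exprn_gt0.
have x0 : 0 < y * Q%:R ^+ n by rewrite mulr_gt0.
have r0 k : (0 : R) <= (5%:R / 7%:R) ^+ k by rewrite exprn_ge0.
have [pn|np] := leqP p n.
  apply: (@le_trans _ _ ((y ^+ 2)^-1 * (Q%:R ^+ n)^-1)).
    have -> : (y ^+ 2)^-1 * (Q%:R ^+ n)^-1 =
        (y * Q%:R ^+ n)^-1 ^+ 2 * (Q%:R ^+ n) :> R.
      by field; rewrite !gt_eqF.
    rewrite ler_wpM2l ?sqr_ge0 //.
    apply: (@le_trans _ _ (Q%:R ^+ p * 1)); first by rewrite ler_wpM2l // ltW.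
    by rewrite mulr1 ler_weXn2l // ler1n (leq_trans _ Q2).
  have := @invX_le_5_7 R Q n (n + p) Q2 (leq_add (leqnn _) pn).
  move: (r0 (n + p)%N); set u := _ ^+ (n + p); set v := _^-1 in y2 *.
  move=> u0 uv; rewrite mulrDl mul1r.
  have := ler_wpM2l (ltW y2) uv; lra.
apply: (@le_trans _ _ (Q%:R ^+ p)^-1).
  have -> : (Q%:R ^+ p)^-1 = (y * Q%:R ^+ n)^-1 ^+ 2 *
      (Q%:R ^+ p * (y * Q%:R ^+ n / Q%:R ^+ p) ^+ 2) :> R.
    by field; rewrite !gt_eqF.
  by rewrite ler_wpM2l ?sqr_ge0 // ler_wpM2l // ltW.
have := @invX_le_5_7 R Q p (n + p) Q2 (leq_add (ltnW np) (leqnn _)).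
move=> /le_trans; apply.
by rewrite ler_peMl // lerDl ltW.
Qed.

(** * Almost sure limit of the normalized tree size *)

Section splitting_tree.
Context {R : realType} {d : measure_display} {T : measurableType d}
  (P : probability T R) (N : R.-ker T ~> measurableTypeR R) (Q D : nat) (y : R).
Hypotheses (Q_ge2 : (2 <= Q)%N) (D_ge2 : (2 <= D)%N) (y_gt0 : 0 < y).
Hypothesis hN : poisson_process P (lebesgue_Rplus R) N.

Let Q_gt0 : (0 : R) < Q%:R.
Proof. by rewrite ltr0n (leq_trans _ Q_ge2). Qed.

Let tail_ge0 x : 0 <= x -> 0 <= poisson_tail D x :> R.
Proof. by rewrite -(ltn_predK D_ge2); exact: poisson_tail_ge0. Qed.

(** The expectation of [level_density n p] for j = n - p: it depends on n and p only through the
    interval length y Q^j. *)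
Definition level_mean (j : int) : R :=
  (y * Q%:R ^ j)^-1 * poisson_tail D (y * Q%:R ^ j).

(* The quantity Z(n, p) of the header. *)
Definition level_density (n p : nat) (w : T) : R :=
  (y * Q%:R ^+ n)^-1 * \sum_(0 <= k < Q ^ p)
    phi D (N w) (y * Q%:R ^+ n * k%:R / Q%:R ^+ p)
                (y * Q%:R ^+ n * k.+1%:R / Q%:R ^+ p).

Let yQ_gt0 (j : int) : 0 < y * Q%:R ^ j.
Proof. by rewrite mulr_gt0 // exprz_gt0. Qed.

Lemma level_mean_ge0 j : 0 <= level_mean j.
Proof. by rewrite mulr_ge0 ?invr_ge0 ?tail_ge0 // ltW. Qed.

Lemma level_meanE j :
  (((y * Q%:R ^ j)^-1)%:E * P (crowded N D 0 (y * Q%:R ^ j)))%E =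
  (level_mean j)%:E.
Proof. by rewrite (probability_crowded hN) ?subr0 // ltW. Qed.

(** For j >= 0 the tail is at most 1, leaving y^-1 Q^-j; for j < 0 its quadratic bound leaves y
    Q^j. *)
Lemma esum_level_mean_lty :
  (\esum_(j in [set: int]) (level_mean j)%:E < +oo)%E.
Proof.
rewrite esum_int => [|j]; last by rewrite lee_fin level_mean_ge0.
have Qi : 0 <= (Q%:R^-1 : R) < 1.
  by rewrite invr_ge0 ltW //= invf_lt1 // ltr1n.
rewrite lte_add_pinfty //.
- apply: (@le_lt_trans _ _ (\sum_(0 <= i <oo) (y^-1 * Q%:R^-1 ^+ i)%:E)%E).
    apply: lee_nneseries => [i _ _|i _]; rewrite lee_fin ?level_mean_ge0 //.
    rewrite exprVn -invfM -[leRHS]mulr1 /level_mean.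
    apply: ler_wpM2l; first by rewrite invr_ge0 ltW.
    by apply: poisson_tail_le1; rewrite ltW.
  by rewrite nneseries_geometric ?ltry // invr_ge0 ltW.
- apply: (@le_lt_trans _ _ (\sum_(0 <= i <oo) (y * Q%:R^-1 ^+ i)%:E)%E).
    apply: lee_nneseries => [i _ _|i _]; rewrite lee_fin ?level_mean_ge0 //.
    apply: (@le_trans _ _ (y * Q%:R ^ (Negz i))).
      rewrite -ler_pdivlMl ?invr_gt0 // invrK -expr2.
      by apply: poisson_tail_le_sqr => //; rewrite ltW.
    (* Q^-(i+1) is relaxed to Q^-i. *)
    rewrite ler_wpM2l ?(ltW y_gt0) // NegzE -exprnN exprVn.
    by rewrite lef_pV2 ?posrE ?exprn_gt0 // ler_weXn2l // ler1n ltnW.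
  by rewrite nneseries_geometric ?ltry // ltW.
Qed.

Let phi_indic (w : T) (a b : R) : phi D (N w) a b = \1_(crowded N D a b) w.
Proof. by rewrite /phi indicE /crowded; congr ((nat_of_bool _)%:R); apply/idP/idP; rewrite inE. Qed.

Lemma measurable_level_density n p : measurable_fun setT (level_density n p).
Proof.
apply: measurable_funM => //; apply: measurable_sum => k.
under eq_fun do rewrite phi_indic.
exact/measurable_indic/measurable_crowded.
Qed.

Lemma level_density_ge0 n p w : 0 <= level_density n p w.
Proof.
by rewrite mulr_ge0 ?invr_ge0 ?(ltW (yQ_gt0 n)) // sumr_ge0.
Qed.

(** The Q^p intervals of level p are disjoint with common length l = y Q^(n-p), so their indicators
    are pairwise independent with equal means, and [count_L1_deviation] applies with c = 1/(y
    Q^n). *)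
Lemma level_density_deviation n p :
  (\int[P]_w `|level_density n p w - level_mean (n%:Z - p%:Z)|%:E <=
   ((1 + (y ^+ 2)^-1) * (6%:R / 7%:R) ^+ (n + p))%:E)%E.
Proof.
pose x := y * Q%:R ^+ n; pose l := x / Q%:R ^+ p.
have Qp : (0 : R) < Q%:R ^+ p by rewrite exprn_gt0.
have x0 : 0 < x by rewrite mulr_gt0 ?exprn_gt0.
have l0 : 0 < l by rewrite divr_gt0.
have lE : y * Q%:R ^ (n%:Z - p%:Z) = l.
  by rewrite expfzDr ?gt_eqF // mulrA -exprnN.
pose a k := x * k%:R / Q%:R ^+ p.
have a0 k : 0 <= a k by rewrite divr_ge0 // ?mulr_ge0 // ltW.
have a_le j k : (j <= k)%N -> a j <= a k.
  by move=> jk; rewrite ler_pM2r ?invr_gt0 // ler_pM2l // ler_nat.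
pose A k := crowded N D (a k) (a k.+1).
have mA k : measurable (A k) by exact: measurable_crowded.
have PA k : P (A k) = (poisson_tail D l)%:E.
  rewrite (probability_crowded hN) ?a_le //; congr (_%:E); congr poisson_tail.
  by rewrite /a /l -natr1; field; rewrite gt_eqF.
have PAI j k : (j < k < Q ^ p)%N ->
    P (A j `&` A k) = (poisson_tail D l ^+ 2)%:E.
  move=> /andP[jk _]; rewrite (probability_crowdedI hN) ?a_le //.
  by rewrite -[X in (X * _)%E]/(P (A j)) -[X in (_ * X)%E]/(P (A k)) !PA -EFinM expr2.
(* The variance is O((5/7)^(n+p)); with t = (6/5)^(n+p), both t * variance
   and 1/t are O((6/7)^(n+p)). *)
pose t : R := (6%:R / 5%:R) ^+ (n + p).
have t0 : 0 < t by rewrite exprn_gt0.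
have q0 := tail_ge0 _ (ltW l0).
have devE w : level_density n p w - level_mean (n%:Z - p%:Z) =
    x^-1 * (\sum_(0 <= k < Q ^ p) \1_(A k) w - (Q ^ p)%:R * poisson_tail D l).
  rewrite /level_density /level_mean lE [RHS]mulrBr natrX; congr (_ - _).
    by congr (_ * _); apply: eq_bigr => k _; rewrite phi_indic.
  by rewrite /l; field; rewrite !gt_eqF.
under eq_integral do rewrite devE.
apply: le_trans (count_L1_deviation mA (fun k _ => PA k) PAI _ _ t0 q0) _.
rewrite lee_fin natrX.
have := deviation_rate Q n p y _ Q_ge2 y_gt0 q0 (poisson_tail_le1 D _ (ltW l0))
  (poisson_tail_le_sqr D _ D_ge2 (ltW l0)).
rewrite -/x; set V := x^-1 ^+ 2 * _ => VC.
have y2 : 0 <= (y ^+ 2)^-1 by rewrite invr_ge0 sqr_ge0.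
have h1 : t * V <= (1 + (y ^+ 2)^-1) * (6%:R / 7%:R) ^+ (n + p).
  apply: le_trans (ler_wpM2l (ltW t0) VC) _.
  rewrite mulrCA /t -exprMn.
  by rewrite (_ : 6%:R / 5%:R * (5%:R / 7%:R) = 6%:R / 7%:R :> R) //; field.
(* Here 5/6 <= 6/7 is used. *)
have h2 : t^-1 <= (6%:R / 7%:R) ^+ (n + p).
  rewrite /t -exprVn; apply: lerXn2r; rewrite ?nnegrE; lra.
have h3 : 0 <= (6%:R / 7%:R : R) ^+ (n + p) by rewrite exprn_ge0.
(* With C = 1 + y^-2 and r = (6/7)^(n+p), half of C r + r is at most C r because C >= 1. *)
nra.
Qed.

Lemma calR1_level_density n w :
  (calR1 Q D (N w) (y * Q%:R ^+ n) * ((y * Q%:R ^+ n)^-1)%:E)%E =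
  (((y * Q%:R ^+ n)^-1)%:E +
   Q%:R%:E * \sum_(0 <= p <oo) (level_density n p w)%:E)%E.
Proof.
have x0 : 0 <= (y * Q%:R ^+ n)^-1 by rewrite invr_ge0 (ltW (yQ_gt0 n)).
have s0 p : (0 <= \sum_(0 <= k < Q ^ p)
    (phi D (N w) (y * Q%:R ^+ n * k%:R / Q%:R ^+ p)
                 (y * Q%:R ^+ n * k.+1%:R / Q%:R ^+ p))%:E)%E.
  by apply: sume_ge0 => k _; rewrite lee_fin.
rewrite /calR1 ge0_muleDl ?mul1e //; last first.
  by rewrite mule_ge0 // nneseries_ge0.
congr (_ + _)%E; rewrite -muleA; congr (_ * _)%E.
rewrite muleC -nneseriesZl //; apply: eq_eseriesr => p _.
by rewrite /level_density EFinM sumEFin.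
Qed.

(** The root contributes 1/(y Q^n), a geometric sequence tending to 0. The deviations have summable
    means, so almost surely the levels together contribute the sum of the level means. *)
Lemma calR1_ae_cvg :
  {ae P, forall w,
    (calR1 Q D (N w) (y * Q%:R ^+ n) * ((y * Q%:R ^+ n)^-1)%:E)%E
      @[n --> \oo] -->
    (Q%:R%:E * \esum_(j in [set: int]) (level_mean j)%:E)%E}.
Proof.
pose dv n p w := `|level_density n p w - level_mean (n%:Z - p%:Z)|.
have mf n p : measurable_fun setT (dv n p).
  apply: measurableT_comp => //; apply: measurable_funB; last by [].
  exact: measurable_level_density.
have dvoo : (\sum_(0 <= n <oo) \sum_(0 <= p <oo) \int[P]_w (dv n p w)%:E < +oo)%E.
  apply: (@le_lt_trans _ _ (\sum_(0 <= n <oo) \sum_(0 <= p <oo)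
      ((1 + (y ^+ 2)^-1) * (6%:R / 7%:R) ^+ (n + p))%:E)%E).
    have i0 n p : (0 <= \int[P]_w (dv n p w)%:E)%E.
      by apply: integral_ge0 => w _; rewrite lee_fin normr_ge0.
    apply: lee_nneseries => [n _ _|n _]; first exact: nneseries_ge0.
    by apply: lee_nneseries => // p _; exact: level_density_deviation.
  apply: nneseries_geometric2_lty; last by apply/andP; split; lra.
  by rewrite addr_ge0 // invr_ge0 sqr_ge0.
have := nneseries_integral_lty_ae_cvg0 P dv mf (fun _ _ _ => normr_ge0 _) dvoo.
apply: filterS => w dev; under eq_fun do rewrite calR1_level_density.
rewrite -[(_ * esum _ _)%E]add0e; apply: cvgeD.
- by rewrite fin_num_adde_defr.
- apply: cvg_EFin; first by near=> n.
  rewrite (_ : _ \o _ = geometric y^-1 Q%:R^-1).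
    by apply: cvg_geometric; rewrite ger0_norm ?invr_ge0 ?(ltW Q_gt0) // invf_lt1 // ltr1n.
  by apply/funext => n /=; rewrite invfM exprVn.
- apply: cvgeZl => //; apply: cvg_nneseries_approx => //.
  + by move=> n p; exact: level_density_ge0.
  + exact: level_mean_ge0.
  + exact: esum_level_mean_lty.
Unshelve. all: by end_near. Qed.
End splitting_tree.

(** * Identification of the limit with [F1] *)

Lemma exprz_expR {R : realType} (Q : R) (n : int) : 0 < Q ->
  Q ^ n = expR (n%:~R * ln Q).
Proof.
by move=> Q0; rewrite -powR_intmul ?ltW // /powR gt_eqF.
Qed.

(** Tonelli's theorem for a sum over Z, through the two series of [esum_int]. *)
Lemma ge0_integral_esum_int {R : realType} {d : measure_display}
    {T : measurableType d} (mu : {measure set T -> \bar R}) (A : set T)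
    (f : int -> T -> \bar R) :
  measurable A -> (forall n, measurable_fun A (f n)) ->
  (forall n x, A x -> (0 <= f n x)%E) ->
  measurable_fun A (fun x => \esum_(n in [set: int]) f n x)%E /\
  (\int[mu]_(x in A) (\esum_(n in [set: int]) f n x) =
   \esum_(n in [set: int]) \int[mu]_(x in A) f n x)%E.
Proof.
move=> mA mf f0.
have mS (e : nat -> int) :
    measurable_fun A (fun x => \sum_(0 <= i <oo) f (e i) x)%E.
  apply: (ge0_emeasurable_sum (P := xpredT)) => // i x Ax _; exact: f0.
have iS (e : nat -> int) : (\int[mu]_(x in A) (\sum_(0 <= i <oo) f (e i) x) =
    \sum_(0 <= i <oo) \int[mu]_(x in A) f (e i) x)%E.
  by apply: integral_nneseries => // i x; exact: f0.
have fE x : x \in A -> (\esum_(n in [set: int]) f n x)%E =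
    (\sum_(0 <= i <oo) f (Posz i) x + \sum_(0 <= i <oo) f (Negz i) x)%E.
  by move=> /set_mem Ax; apply: esum_int => n; exact: f0.
split.
  apply: eq_measurable_fun (emeasurable_funD (mS Posz) (mS Negz)).
  by move=> x xA; rewrite fE.
under eq_integral => x xA do rewrite fE //.
rewrite ge0_integralD //.
- rewrite !iS esum_int // => n; apply: integral_ge0 => x; exact: f0.
- by move=> x Ax; apply: nneseries_ge0 => i _ _; exact: f0.
- by move=> x Ax; apply: nneseries_ge0 => i _ _; exact: f0.
Qed.

Lemma ge0_esumZl {R : realType} (c : R) (a : int -> \bar R) : 0 <= c ->
  (forall n, (0 <= a n)%E) ->
  (\esum_(n in [set: int]) (c%:E * a n) = c%:E * \esum_(n in [set: int]) a n)%E.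
Proof.
move=> c0 a0; rewrite !esum_int // => [|n]; last exact: mule_ge0.
by rewrite !nneseriesZl // -ge0_muleDr // nneseries_ge0.
Qed.

Section periodic_limit.
Context {R : realType} (Q D : nat) (y : R).
Hypotheses (Q_ge2 : (2 <= Q)%N) (D_ge2 : (2 <= D)%N) (y_gt0 : 0 < y).

Let Q_gt0 : (0 : R) < Q%:R.
Proof. by rewrite ltr0n (leq_trans _ Q_ge2). Qed.

Let Q_gt1 : (1 : R) < Q%:R.
Proof. by rewrite ltr1n. Qed.

Let lnQ_gt0 : (0 : R) < ln Q%:R.
Proof. exact: ln_gt0. Qed.

Let yQ_gt0 (j : int) : 0 < y * Q%:R ^ j.
Proof. by rewrite mulr_gt0 // exprz_gt0. Qed.

(** This is log_Q (y/u), the argument of the fractional part in [F1] at log_Q y. *)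
Let z u : R := logb Q y - logb Q u.

(** Taking logarithms gives -n <= z u, which for an integer n means -n <= floor (z u). *)
Let le_scale u (n : int) : 0 < u ->
  (u <= y * Q%:R ^ n) = (- Num.floor (z u) <= n).
Proof.
move=> u0; rewrite lerNl floor_ge_int -ler_ln ?posrE //.
rewrite lnM ?posrE ?exprz_gt0 // exprz_expR // expRK /z /logb -mulrBl.
rewrite ler_pdivlMr // mulrNz mulNr lerNl opprB lerBlDl.
by [].
Qed.

(** The nonzero terms start at n0 = - floor (z u) and form a geometric series, with sum Q/(Q - 1)
    times the first term; since y = u Q^(z u), y Q^n0 is u Q^frac(z u). *)
Lemma esum_scale u : 0 < u ->
  (\esum_(n in [set: int])
    (if (u <= y * Q%:R ^ n)%R then ((y * Q%:R ^ n)^-1)%:E else 0) =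
   (Q%:R / (Q%:R - 1) * (Q%:R `^ (- Defs.frac (z u)) / u))%:E)%E.
Proof.
move=> u0; set n0 := - Num.floor (z u).
transitivity (\esum_(n in [set n : int | (n0 <= n)%R]) ((y * Q%:R ^ n)^-1)%:E)%E.
  rewrite [RHS]esum_mkcond; apply: eq_esum => n _; rewrite le_scale //.
  by case: ifPn => h; [rewrite mem_set|rewrite memNset //; exact/negP].
rewrite (reindex_esum setT _ (fun i : nat => n0 + i%:Z)); last first.
  split => /= [i _|i j _ _ /addrI []//|n /= n0n]; first by rewrite /= lerDl.
  by exists `|n - n0|%N => //; rewrite gez0_abs ?subr_ge0 // subrKC.
rewrite -nneseries_esumT => [|i]; last by rewrite lee_fin invr_ge0 ltW.
rewrite (eq_eseriesr (g := fun i => ((y * Q%:R ^ n0)^-1 * Q%:R^-1 ^+ i)%:E)) => [|i _]; last first.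
  by rewrite expfzDr ?gt_eqF // mulrA invfM exprVn.
rewrite nneseries_geometric ?invr_ge0 ?(ltW (yQ_gt0 _)) //; last first.
  by rewrite (ltW Q_gt0) /= invf_lt1.
congr (_%:E).
have -> : (y * Q%:R ^ n0)^-1 = Q%:R `^ (- Defs.frac (z u)) / u.
  have zE : z u * ln Q%:R = ln y - ln u.
    by rewrite /z /logb mulrBl !divfK // gt_eqF.
  have vE v : 0 < v -> v^-1 = expR (- ln v) by move=> v0; rewrite expRN lnK.
  rewrite /powR gt_eqF // exprz_expR // /Defs.frac invfM !vE ?expR_gt0 // expRK.
  rewrite -!expRD; congr expR; rewrite /n0.
  move: (z u) zE => c zE; rewrite opprB mulrBl zE mulrNz; ring.
by field; rewrite !gt_eqF // subr_gt0.
Qed.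

Let g (u : R) : R := u ^+ (D - 1) / (D - 1)`!%:R * expR (- u).

Let h (u : R) : R := Q%:R `^ (- Defs.frac (z u)) * (u ^+ (D - 2) / (D - 1)`!%:R)
       * expR (- u).

Let g_ge0 u : 0 <= u -> 0 <= g u.
Proof. by move=> u0; rewrite mulr_ge0 ?expR_ge0 // divr_ge0 ?exprn_ge0. Qed.

(** The sum over scales contributes 1/u, which lowers the power in the Gamma density [g] from D - 1
    to D - 2; the factor (Q - 1)/Q cancels the geometric sum. *)
Let hE u : 0 < u -> (h u)%:E = (((Q%:R - 1) / Q%:R)%:E *
  \esum_(n in [set: int])
   ((g u)%:E * (if (u <= y * Q%:R ^ n)%R then ((y * Q%:R ^ n)^-1)%:E else 0)))%E.
Proof.
move=> u0; rewrite ge0_esumZl ?g_ge0 ?(ltW u0) // => [|n]; last first.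
  by case: ifP => // _; rewrite lee_fin invr_ge0 ltW.
rewrite esum_scale // -!EFinM; congr (_%:E).
have -> : g u = u * (u ^+ (D - 2) / (D - 1)`!%:R * expR (- u)).
  by rewrite /g (_ : (D - 1 = (D - 2).+1)%N) ?exprS ?mulrA //; lia.
rewrite /h; set w := _ / _`!%:R; set v := _ `^ _.
by field; rewrite !gt_eqF // subr_gt0.
Qed.

Let measurable_g A : measurable_fun A g.
Proof.
apply: measurable_funM.
  by apply: measurable_funM => //; exact: measurable_funX.
by apply: measurableT_comp => //; apply: measurableT_comp.
Qed.

(** The bound u <= y Q^n sits in the integrand, so that all n share one domain of integration and
    Tonelli applies. *)
Let f (n : int) (u : R) : \bar R :=
  ((g u)%:E * (if (u <= y * Q%:R ^ n)%R then ((y * Q%:R ^ n)^-1)%:E else 0))%E.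

Let f_ge0 n u : `]0%R, +oo[%classic u -> (0 <= f n u)%E.
Proof.
rewrite /= in_itv /= andbT => u0; apply: mule_ge0.
  by rewrite lee_fin g_ge0 // ltW.
by case: ifP => // _; rewrite lee_fin invr_ge0 ltW.
Qed.

Let fE n : f n =
  ((fun u => ((y * Q%:R ^ n)^-1)%:E * (g u)%:E) \_ [set u | (u <= y * Q%:R ^ n)%R])%E.
Proof.
apply/funext => u; rewrite /patch /f.
case: ifPn => h1; first by rewrite mem_set // muleC.
by rewrite memNset ?mule0 //; exact/negP.
Qed.

Let measurable_f n : measurable_fun (`]0%R, +oo[%classic : set R) (f n).
Proof.
have mle : measurable [set u | (u <= y * Q%:R ^ n)%R].
  by rewrite (_ : [set _ | _] = `]-oo, (y * Q%:R ^ n)%R]%classic) //;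
    apply/seteqP; split => u /=; rewrite in_itv.
rewrite fE; apply/(measurable_restrict _ mle) => //.
apply: measurable_funeM; apply/measurable_EFinP; exact: measurable_g.
Qed.

(** The cut-off returns to the domain of integration, and the endpoint 0 is a null set. *)
Let integral_f n : (\int[@lebesgue_measure R]_(u in `]0%R, +oo[) f n u =
  ((y * Q%:R ^ n)^-1)%:E *
  \int[@lebesgue_measure R]_(u in `[0%R, (y * Q%:R ^ n)%R]) (g u)%:E)%E.
Proof.
have mg (A : set R) : measurable_fun A (EFin \o g).
  apply/measurable_EFinP; exact: measurable_g.
rewrite -integral_itv_obnd_cbnd; last exact: mg.
rewrite -ge0_integralZl_EFin //=; last 3 first.
- by move=> u; rewrite in_itv /= => /andP[/ltW u0 _]; rewrite lee_fin g_ge0.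
- exact: mg.
- by rewrite invr_ge0 ltW.
rewrite fE -integral_mkcondr.
rewrite (_ : `]0%R, +oo[%classic `&` [set u | (u <= y * Q%:R ^ n)%R] =
    `]0%R, (y * Q%:R ^ n)%R]%classic) //.
by apply/seteqP; split => u /=; rewrite !in_itv /= andbT; [case=> -> -> | move/andP].
Qed.

Lemma esum_integral_F1 :
  (\esum_(n in [set: int]) (((y * Q%:R ^ n)^-1)%:E *
     \int[@lebesgue_measure R]_(u in `[0%R, (y * Q%:R ^ n)%R]) (g u)%:E) < +oo)%E ->
  (Q%:R%:E * \esum_(n in [set: int]) (((y * Q%:R ^ n)^-1)%:E *
     \int[@lebesgue_measure R]_(u in `[0%R, (y * Q%:R ^ n)%R]) (g u)%:E))%E =
  (F1 Q D (logb Q y))%:E.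
Proof.
have [mS iS] := @ge0_integral_esum_int _ _ _ (@lebesgue_measure R) _ _
  (measurable_itv `]0%R, +oo[) measurable_f f_ge0.
rewrite -(eq_esum (fun n _ => integral_f n)) -iS => Soo.
have S0 u : `]0%R, +oo[%classic u -> (0 <= \esum_(n in [set: int]) f n u)%E.
  by move=> u0; apply: esum_ge0 => n _; exact: f_ge0.
rewrite /F1 /Rintegral.
have -> : (\int[@lebesgue_measure R]_(u in `]0%R, +oo[) (h u)%:E =
    ((Q%:R - 1) / Q%:R)%:E *
    \int[@lebesgue_measure R]_(u in `]0%R, +oo[) (\esum_(n in [set: int]) f n u))%E.
  rewrite -ge0_integralZl_EFin //; last first.
    by apply: divr_ge0; rewrite ?subr_ge0 ltW.
  by apply: eq_integral => u; rewrite inE /= in_itv /= andbT => u0; rewrite hE.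
(* [F1] uses the real-valued integral, which would turn +oo into 0; finiteness makes it agree with
   the extended one. *)
have : (\int[@lebesgue_measure R]_(u in `]0%R, +oo[)
    (\esum_(n in [set: int]) f n u))%E \is a fin_num.
  by rewrite ge0_fin_numE //; exact: integral_ge0.
case: (integral _ _ _) => // r _.
rewrite -!EFinM /=; congr (_%:E).
(* The constants combine as Q^2/(Q - 1) times (Q - 1)/Q, which is Q. *)
by field; rewrite !gt_eqF // subr_gt0.
Qed.

End periodic_limit.

(** * Periodicity and conclusion *)

Lemma periodic_F1 {R : realType} (Q D : nat) : periodic (F1 Q D) (1 : R).
Proof.
move=> x; rewrite /F1; congr (_ * _).
apply: eq_Rintegral => u _; congr (_ `^ (- _) * _ * _).
rewrite /Defs.frac (addrAC x 1) floorDrz ?rpred1 // floor1 intrD; ring.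
Qed.

Theorem proposition14 (R : realType) (d : measure_display)
    (T : measurableType d) (P : probability T R)
    (N : R.-ker T ~> measurableTypeR R) (Q D : nat)
    (hQ : (2 <= Q)%N) (hD : (2 <= D)%N)
    (hN : poisson_process P (lebesgue_Rplus R) N) :
  periodic (F1 Q D) (1 : R) /\
  forall y : R, 0 < y <= Q%:R ->
  [/\ {ae P, forall w,
        ((calR1 Q D (N w) (y * Q%:R ^+ n) * ((y * Q%:R ^+ n)^-1)%:E)%E
          @[n --> \oo] -->
        (Q%:R%:E * \esum_(n in [set: int])
           (((y * Q%:R ^ n)^-1)%:E *
            P [set w' | D%:R%:E <= N w' `]0%R, (y * Q%:R ^ n)%R]%classic]))%E)},
      (Q%:R%:E * \esum_(n in [set: int])
         (((y * Q%:R ^ n)^-1)%:E *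
          P [set w | D%:R%:E <= N w `]0%R, (y * Q%:R ^ n)%R]%classic]))%E =
      (Q%:R%:E * \esum_(n in [set: int])
         (((y * Q%:R ^ n)^-1)%:E *
          \int[@lebesgue_measure R]_(u in `[0%R, (y * Q%:R ^ n)%R])
            (u ^+ (D - 1) / (D - 1)`!%:R * expR (- u))%:E))%E &
      (Q%:R%:E * \esum_(n in [set: int])
         (((y * Q%:R ^ n)^-1)%:E *
          \int[@lebesgue_measure R]_(u in `[0%R, (y * Q%:R ^ n)%R])
            (u ^+ (D - 1) / (D - 1)`!%:R * expR (- u))%:E))%E =
      (F1 Q D (logb Q y))%:E].
Proof.
split; first exact: periodic_F1.
move=> y /andP[y0 _].
have yQ0 j : 0 < y * Q%:R ^ j.
  by rewrite mulr_gt0 // exprz_gt0 // ltr0n (leq_trans _ hQ).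
(* The probabilities and the integrals both yield [level_mean], which serves as the common form of
   the two sums. *)
have PE j : (((y * Q%:R ^ j)^-1)%:E *
    P [set w | D%:R%:E <= N w `]0%R, (y * Q%:R ^ j)%R]%classic])%E =
    (level_mean Q D y j)%:E.
  exact: (level_meanE P N Q D y hQ y0 hN).
have IE j : (((y * Q%:R ^ j)^-1)%:E *
    \int[@lebesgue_measure R]_(u in `[0%R, (y * Q%:R ^ j)%R])
      (u ^+ (D - 1) / (D - 1)`!%:R * expR (- u))%:E)%E = (level_mean Q D y j)%:E.
  rewrite integral_poisson_tail // -EFinM; congr (_ * poisson_tail _ _)%:E.
  by rewrite subn1 (ltn_predK hD).
split.
- under eq_esum do rewrite PE.
  exact: (calR1_ae_cvg P N Q D y hQ hD y0 hN).
- by congr (_ * _)%E; apply: eq_esum => j _; rewrite PE IE.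
- apply: esum_integral_F1 => //.
  by under eq_esum do rewrite IE; exact: (esum_level_mean_lty Q D y).
Qed.
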